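(* Let $f:\mathbb{R}^n\to\mathbb{R}^m$ ($m\ge 2$) with prediction function $F(x)=\operatorname{argmax}_{i\in[m]} f_i(x)$, let $\|\cdot\|$ be a norm on $\mathbb{R}^n$, let $\epsilon>0$, and for each $i\in[m]$ let $K_i$ be an upper bound on the (global) Lipschitz constant of $f_i$ with respect to $\|\cdot\|$. Let $\bar F^{\epsilon}:\mathbb{R}^n\to[m]\cup\{\bot\}$ be the prediction function of the GloRo Net $\bar f^{\epsilon}$ built from $f$, $\epsilon$ and $(K_i)_{i\in[m]}$. For every $x\in\mathbb{R}^n$, if $\bar F^{\epsilon}(x)\neq\bot$, then $\bar F^{\epsilon}(x)=F(x)$ and $F$ is $\epsilon$-locally-robust at $x$ with respect to $\|\cdot\|$.
   Context: $[m]=\{1,\dots,m\}$; $f_i$ is the $i$-th coordinate of $f$. In $F(x)=\operatorname{argmax}_i f_i(x)$, ties are broken by some arbitrary fixed rule, so $F(x)$ is always an index attaining the maximum. Lipschitz bound: $K_i$ is an upper bound on the Lipschitz constant of $f_i$ if $|f_i(x_1)-f_i(x_2)|\le K_i\|x_1-x_2\|$ for all $x_1,x_2\in\mathbb{R}^n$. GloRo Net: for $x\in\mathbb{R}^n$ put $y=f(x)$, $j=F(x)$, and $y_\bot=\max_{i\neq j}\{y_i+(K_i+K_j)\epsilon\}$. The GloRo Net $\bar f^{\epsilon}$ has outputs indexed by $[m]\cup\{\bot\}$, with $\bar f^{\epsilon}_i(x)=y_i$ for $i\in[m]$ and $\bar f^{\epsilon}_\bot(x)=y_\bot$. Its prediction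 $\bar F^{\epsilon}(x)$ is the argmax over $[m]\cup\{\bot\}$ of the outputs of $\bar f^{\epsilon}(x)$, where a tie involving $\bot$ is resolved in favor of $\bot$ (so a class in $[m]$ is predicted only if its output is strictly greater than $\bar f^{\epsilon}_\bot(x)$). Local robustness: $F$ is $\epsilon$-locally-robust at $x$ with respect to $\|\cdot\|$ if for all $x'$, $\|x-x'\|\le\epsilon$ implies $F(x)=F(x')$. *)

(* Defs.v *)
From mathcomp Require Import all_boot all_order all_algebra.
From mathcomp Require Import reals.

Set Implicit Arguments.
Unset Strict Implicit.
Unset Printing Implicit Defensive.

Import Order.TTheory GRing.Theory Num.Theory.
Local Open Scope ring_scope.

Section Defs.
Context {R : realType}.

(* An arbitrary norm on R^n is a plain function, because the canonical
   normed structure of the library on ['rV[R]_n] fixes the sup norm.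
   Nonnegativity follows from the three fields. *)
Record is_norm (n : nat) (N : 'rV[R]_n -> R) : Prop := IsNorm {
  is_norm_triangle : forall x y, N (x + y) <= N x + N y ;
  is_norm_scale : forall (a : R) x, N (a *: x) = `|a| * N x ;
  is_norm_eq0 : forall x, N x = 0 -> x = 0
}.

Definition lipschitz_bound (n : nat) (N : 'rV[R]_n -> R)
    (g : 'rV[R]_n -> R) (k : R) : Prop :=
  forall x1 x2, `|g x1 - g x2| <= k * N (x1 - x2).

Definition is_argmax (I : finType) (y : I -> R) (j : I) : Prop :=
  forall i, y i <= y j.

(* The tie-breaking rule is left unspecified, and may even depend on [x]. *)
Definition is_prediction (n m : nat) (f : 'rV[R]_n -> 'rV[R]_m)
    (F : 'rV[R]_n -> 'I_m) : Prop :=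
  forall x, is_argmax (fun i => f x ord0 i) (F x).

(* The maximum of [g] over [P]; the picked element only provides a value of
   [g] on [P] as the initial value of the iteration.
   Junk value 0 if [P] is empty. *)
Definition max_over (I : finType) (P : pred I) (g : I -> R) : R :=
  if [pick i | P i] is Some i0 then \big[Num.max/g i0]_(i | P i) g i else 0.

Lemma max_overP (I : finType) (P : pred I) (g : I -> R) (i0 : I) : P i0 ->
  (forall i, P i -> g i <= max_over P g) /\
  (exists2 i, P i & max_over P g = g i).
Proof.
rewrite /max_over => Pi0; case: pickP => [k Pk | /(_ i0)]; last by rewrite Pi0.
split=> [i Pi|]; first exact: le_bigmax_cond.
elim/big_ind: _ => [|a b [i Pi ->] [j Pj ->]|i Pi]; [by exists k| |by exists i].
by case: (leP (g i) (g j)) => _; [exists j | exists i].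
Qed.

Definition gloro_bot (n m : nat) (f : 'rV[R]_n -> 'rV[R]_m) (K : 'I_m -> R)
    (eps : R) (F : 'rV[R]_n -> 'I_m) (x : 'rV[R]_n) : R :=
  max_over (fun i => i != F x) (fun i => f x ord0 i + (K i + K (F x)) * eps).

(* The index set [m] + {bot} is ['I_m] extended with [None] for bot. *)
Definition gloro_net (n m : nat) (f : 'rV[R]_n -> 'rV[R]_m) (K : 'I_m -> R)
    (eps : R) (F : 'rV[R]_n -> 'I_m) (x : 'rV[R]_n) (o : option 'I_m) : R :=
  if o is Some i then f x ord0 i else gloro_bot f K eps F x.

(* Ties between classes are again broken arbitrarily, independently of the
   rule used by [F]. *)
Definition is_gloro_prediction (n m : nat) (f : 'rV[R]_n -> 'rV[R]_m)
    (K : 'I_m -> R) (eps : R) (F : 'rV[R]_n -> 'I_m)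
    (Fbar : 'rV[R]_n -> option 'I_m) : Prop :=
  forall x, is_argmax (gloro_net f K eps F x) (Fbar x) /\
    (is_argmax (gloro_net f K eps F x) None -> Fbar x = None).

Definition locally_robust (n : nat) (T : Type) (N : 'rV[R]_n -> R) (eps : R)
    (F : 'rV[R]_n -> T) (x : 'rV[R]_n) : Prop :=
  forall x', N (x - x') <= eps -> F x = F x'.

End Defs.

(* Main.v *)
(** The Lipschitz bounds are nonnegative because [n > 0], so [bot] dominates
    every class other than [F x]; a class strictly above [bot] is therefore
    [F x], and its margin [(K i + K (F x)) * eps] over each other class [i]
    is at least what a move of length [eps] can consume. *)
Require Import Defs.
From mathcomp Require Import all_boot all_order all_algebra.
From mathcomp Require Import reals.
From mathcomp Require Import lra.

Import Order.TTheory GRing.Theory Num.Theory.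
Local Open Scope ring_scope.

Lemma is_norm_ge0 (R : realType) (n : nat) (N : 'rV[R]_n -> R) :
  is_norm N -> forall x, 0 <= N x.
Proof.
move=> hN x.
have N0 : N 0 = 0 by rewrite -(scale0r x) (is_norm_scale hN) normr0 mul0r.
have NN : N (- x) = N x by rewrite -scaleN1r (is_norm_scale hN) normrN1 mul1r.
by have := is_norm_triangle hN x (- x); rewrite subrr N0 NN; lra.
Qed.

(** Comparing [g] at [0] and at a vector [v] of positive norm gives [0 <= k * N v]; the all-ones
    vector is nonzero because [n > 0]. *)
Lemma lipschitz_bound_ge0 (R : realType) (n : nat) (N g : 'rV[R]_n -> R)
    (k : R) : (0 < n)%N -> is_norm N -> lipschitz_bound N g k -> 0 <= k.
Proof.
move=> n_gt0 hN hk; pose v : 'rV[R]_n := const_mx 1.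
have Nv_gt0 : 0 < N v.
  rewrite lt_neqAle is_norm_ge0 // andbT eq_sym; apply/eqP => /(is_norm_eq0 hN).
  move/rowP/(_ (Ordinal n_gt0)); rewrite !mxE; apply/eqP; exact: oner_neq0.
by rewrite -(pmulr_lge0 _ Nv_gt0); have := hk v 0; rewrite subr0; apply: le_trans.
Qed.

(** From [x] to [x'], [g] rises by at most [k * eps] and [h] drops by at most [l * eps]; the signs
    of [k] and [l] allow [N (x - x')] to be replaced by [eps]. *)
Lemma lipschitz_gap (R : realType) (n : nat) (N g h : 'rV[R]_n -> R)
    (k l eps : R) (x x' : 'rV[R]_n) :
  0 <= k -> 0 <= l -> lipschitz_bound N g k -> lipschitz_bound N h l ->
  N (x - x') <= eps -> g x + (k + l) * eps < h x -> g x' < h x'.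
Proof.
move=> k_ge0 l_ge0 hg hh le_eps gap.
have := hg x x'; have := hh x x'; rewrite !ler_norml => /andP[_ hl] /andP[hk _].
have := ler_wpM2l k_ge0 le_eps; have := ler_wpM2l l_ge0 le_eps.
by move: gap; rewrite mulrDl; lra.
Qed.

Theorem theorem1 (R : realType) (n m : nat) (hn : (0 < n)%N) (hm : (2 <= m)%N)
    (f : 'rV[R]_n -> 'rV[R]_m) (F : 'rV[R]_n -> 'I_m)
    (hF : is_prediction f F)
    (N : 'rV[R]_n -> R) (hN : is_norm N)
    (eps : R) (heps : 0 < eps)
    (K : 'I_m -> R)
    (hK : forall i : 'I_m, lipschitz_bound N (fun x => f x ord0 i) (K i))
    (Fbar : 'rV[R]_n -> option 'I_m)
    (hFbar : is_gloro_prediction f K eps F Fbar)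
    (x : 'rV[R]_n) :
  Fbar x <> None -> Fbar x = Some (F x) /\ locally_robust N eps F x.
Proof.
have K_ge0 i : 0 <= K i by exact: lipschitz_bound_ge0 hn hN (hK i).
have [Fbar_max bot_tie] := hFbar x.
case E: (Fbar x) Fbar_max bot_tie => [c|//] c_max bot_tie _.
(* Otherwise [None] would also attain the maximum, and the tie rule would force [Fbar x = None]. *)
have bot_lt : gloro_bot f K eps F x < f x ord0 c.
  rewrite ltNge; apply/negP => c_le.
  by have // := bot_tie (fun o => le_trans (c_max o) c_le).
have margin i : i != F x -> f x ord0 i + (K i + K (F x)) * eps < f x ord0 c.
  move=> iF; apply: le_lt_trans bot_lt.
  exact: (max_overP (P := fun k => k != F x) _ iF).1 i iF.
(* If [c] differed from [F x], [margin] at [c] itself would put [f x ord0 c] plus a nonnegative term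
   strictly below [f x ord0 c]. *)
have cF : c = F x.
  apply/eqP; apply: contraT => /margin; rewrite ltNge lerDl.
  by rewrite mulr_ge0 ?addr_ge0 // ltW.
subst c; split=> // x' le_eps.
(* Here [margin] is taken at the class [F x']: its gap below [F x] would persist at [x'], where
   [F x'] is maximal. *)
apply/eqP; apply: contraT; rewrite eq_sym => /margin gap.
have := lipschitz_gap _ _ _ _ _ _ _ _ _ _
  (K_ge0 _) (K_ge0 _) (hK _) (hK _) le_eps gap.
by rewrite ltNge (hF x').
Qed.
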